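(* Let $T>0$, $I=[0,T]$, let $\kappa\in\mathscr{K}_{\mathrm{reg}}$ be a regular admissible kernel and let $\Lambda\in\mathscr{A}(I)$ be an adaptive sensitivity function. Then: (1) $\mathcal{C}(I)\subset\mathscr{M}_{\kappa,\Lambda}(I)$; in particular, $\mathscr{M}_{\kappa,\Lambda}(I)$ is nonempty. (2) For every $f\in\mathcal{C}(I)$, $$\|f\|_\infty\le S_{\kappa,\Lambda}(f)\le\bigl(1+\Lambda_\infty\kappa_\infty T\bigr)\|f\|_\infty,$$ where $\Lambda_\infty:=\sup_{(s,x)\in I\times\mathbb{R}}\Lambda(s,x)$ and $\kappa_\infty:=\sup_{\tau\in I}\kappa(\tau)$.
   Context: Fix $T>0$ and $I=[0,T]$. $\mathcal{C}(I)$ is the set of continuous functions $I\to\mathbb{R}$ and $\|f\|_\infty:=\sup_{t\in I}|f(t)|$. Regular admissible kernels: $\mathscr{K}_{\mathrm{reg}}$ is the set of Lebesgue measurable, integrable functions $\kappa:I\to[0,\infty)$ such that (uniform boundedness) there are constants $0<m_\kappa\le M_\kappa<\infty$ with $m_\kappa\le\kappa(\tau)\le M_\kappa$ for all $\tau\in I$; (normalization) $\int_0^T\kappa(\tau)\,d\tau=1$; (Lipschitz continuity) there is $L_\kappa>0$ with $|\kappa(\tau_1)-\kappa(\tau_2)|\le L_\kappa|\tau_1-\tau_2|$ for all $\tau_1,\tau_2\in I$. Adaptive sensitivity functions: $\mathscr{A}(I)$ is the set of functions $\Lambda:I\times\mathbb{R}\to[0,\infty)$ such that: there are constants $0<\lambda_{\min}\le\lambda_{\max}<\infty$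 with $\lambda_{\min}\le\Lambda(s,x)\le\lambda_{\max}$ for all $(s,x)\in I\times\mathbb{R}$; there is $L_\Lambda>0$ with $|\Lambda(s,x)-\Lambda(s,y)|\le L_\Lambda|x-y|$ for all $s\in I$, $x,y\in\mathbb{R}$; for every fixed $x\in\mathbb{R}$, $s\mapsto\Lambda(s,x)$ is Lebesgue measurable on $I$; there is $\varrho>0$ with $\Lambda(s,0)\ge\varrho$ for all $s\in I$. Adaptive memory-dependent functional: for a function $f:I\to\mathbb{R}$ for which the integrals below exist as Lebesgue integrals for every $t\in I$, $$S_{\kappa,\Lambda}(f):=\sup_{t\in I}\left(|f(t)|+\int_0^t\Lambda(s,f(s))\,\kappa(t-s)\,|f(s)|\,ds\right).$$ Adaptive memory-dependent sensitivity set: $\mathscr{M}_{\kappa,\Lambda}(I):=\{f:I\to\mathbb{R}\mid S_{\kappa,\Lambda}(f)<\infty\}$, i.e. the set of functions for which $S_{\kappa,\Lambda}(f)$ is well-defined (the integrals exist as Lebesgue integrals) and finite. *)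

(* Defs.v *)
From mathcomp Require Import all_boot all_order all_algebra.
From mathcomp Require Import all_classical all_reals all_analysis.

Set Implicit Arguments.
Unset Strict Implicit.
Unset Printing Implicit Defensive.

Import Order.TTheory GRing.Theory Num.Theory.
Import numFieldNormedType.Exports.

Local Open Scope classical_set_scope.
Local Open Scope ring_scope.

(* The real line with its Lebesgue-measurable sets.  The default sigma-algebra
   on R is the Borel one, while measurability below is meant with respect to
   its completion, which is the sigma-algebra of the Caratheodory-measurable
   sets (completed_caratheodory_measurable). *)
Notation lebesgueType R :=
  (caratheodory_type ((@wlength R (idfun : cumulative R R))^*)%mu).

(* Functions on I = [0, T] are total functions on R of which only the values
   on I matter. *)

Section definitions.
Context {R : realType}.
Implicit Types (T : R) (f kappa : R -> R) (Lambda : R -> R -> R).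

Local Notation mu := (@completed_lebesgue_measure R).

Definition lebesgue_measurable_fun (D : set R) (f : R -> R) : Prop :=
  measurable_fun (D : set (lebesgueType R)) (f : lebesgueType R -> R).

Record regular_kernel T kappa : Prop := {
  kernel_ge0 : forall tau : R, tau \in `[0, T] -> 0 <= kappa tau;
  kernel_measurable : lebesgue_measurable_fun `[0, T] kappa;
  kernel_integrable : mu.-integrable `[0, T] (EFin \o kappa);
  kernel_bounded : exists m M : R, [/\ 0 < m, m <= M &
    forall tau : R, tau \in `[0, T] -> m <= kappa tau <= M];
  kernel_normalized : (\int[mu]_(tau in `[0%R, T]) (kappa tau)%:E = 1)%E;
  kernel_lipschitz : exists2 L : R, 0 < L &
    forall tau1 tau2 : R, tau1 \in `[0, T] -> tau2 \in `[0, T] ->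
      `|kappa tau1 - kappa tau2| <= L * `|tau1 - tau2|
}.

Record adaptive_sensitivity T Lambda : Prop := {
  sensitivity_ge0 : forall s x : R, s \in `[0, T] -> 0 <= Lambda s x;
  sensitivity_bounded : exists lmin lmax : R, [/\ 0 < lmin, lmin <= lmax &
    forall s x : R, s \in `[0, T] -> lmin <= Lambda s x <= lmax];
  sensitivity_lipschitz : exists2 L : R, 0 < L &
    forall s x y : R, s \in `[0, T] ->
      `|Lambda s x - Lambda s y| <= L * `|x - y|;
  sensitivity_measurable :
    forall x : R, lebesgue_measurable_fun `[0, T] (Lambda ^~ x);
  sensitivity_at0 : exists2 rho : R, 0 < rho &
    forall s : R, s \in `[0, T] -> rho <= Lambda s 0
}.

Definition memory_integrand kappa Lambda f (t s : R) : R :=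
  Lambda s (f s) * kappa (t - s) * `|f s|.

(* Meaningful only for f such that [memory_well_defined T kappa Lambda f]. *)
Definition memory_functional T kappa Lambda f : \bar R :=
  ereal_sup [set (`|f t|%:E +
     \int[mu]_(s in `[0%R, t]) (memory_integrand kappa Lambda f t s)%:E)%E
   | t in `[0, T]].

(* The integrands being nonnegative, their Lebesgue integrals exist in
   [0, +oo] as soon as they are measurable. *)
Definition memory_well_defined T kappa Lambda f : Prop :=
  forall t : R, t \in `[0, T] ->
    lebesgue_measurable_fun `[0, t] (memory_integrand kappa Lambda f t).

Definition memory_set T kappa Lambda : set (R -> R) :=
  [set f | memory_well_defined T kappa Lambda f /\
           (memory_functional T kappa Lambda f < +oo)%E].

Definition continuous_on T : set (R -> R) :=
  [set f | {within `[0, T], continuous f}].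

(* The next three suprema are real-valued [sup]s; the sets are nonempty and
   bounded when f is continuous on [0, T], kappa is a regular kernel, Lambda is
   an adaptive sensitivity function and T > 0. *)
Definition sup_norm T f : R := sup [set `|f t| | t in `[0, T]].

Definition kernel_sup T kappa : R := sup [set kappa tau | tau in `[0, T]].

Definition sensitivity_sup T Lambda : R :=
  sup [set Lambda s x | s in `[0, T] & x in setT].

End definitions.

(* Main.v *)
Require Import Defs.
From mathcomp Require Import all_boot all_order all_algebra.
From mathcomp Require Import all_classical all_reals all_analysis.
From mathcomp Require Import measurable_realfun.

Import Order.TTheory GRing.Theory Num.Theory.
Import numFieldNormedType.Exports.

Local Open Scope classical_set_scope.
Local Open Scope ring_scope.

(** Each of the three factors of the integrand is bounded on [0, T], by the
    suprema of Lambda, kappa and |f|, so once the integrand is known to be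
    measurable its integral over [0, t] is at most the product of the three
    suprema and t; adding |f t| and taking the supremum over t gives the upper
    bound, and its finiteness gives membership in the memory set.  The lower
    bound holds because the integrand is nonnegative.

    The real content is measurability.  Lambda is only separately regular:
    measurable in s and Lipschitz, hence continuous, in x.  Such Caratheodory
    functions are superpositionally measurable: rounding f down to a grid of
    mesh 1 / (n + 1) makes s |-> Lambda s (f s) a countable gluing of the
    measurable functions Lambda ^~ x, and letting n grow recovers the original
    superposition by continuity in x ([measurable_superposition]).  The
    remaining factors are Borel, hence Lebesgue measurable, on [0, t] because
    they are continuous there: f by hypothesis and the reflected kernel
    s |-> kappa (t - s) because kappa is Lipschitz. *)

(** * Superpositional measurability *)

Definition grid_floor {R : realType} (n : nat) (x : R) : R :=
  (Num.floor (x * n.+1%:R))%:~R / n.+1%:R.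

Lemma grid_floor_itv {R : realType} (n : nat) (x : R) :
  x - n.+1%:R^-1 <= grid_floor n x <= x.
Proof.
have n0 : 0 < n.+1%:R :> R by [].
have /andP[lo hi] := floor_itv (x * n.+1%:R).
rewrite /grid_floor ler_pdivlMr// ler_pdivrMr// lo andbT.
by rewrite mulrBl mulVf ?gt_eqF// lerBlDr -[1]/(1%:~R) -intrD ltW.
Qed.

Lemma cvg_grid_floor {R : realType} (x : R) :
  grid_floor n x @[n --> \oo] --> x.
Proof.
apply: (@squeeze_cvgr _ _ _ _ (fun n => x - n.+1%:R^-1) (fun=> x)).
- by near=> n; exact: grid_floor_itv.
- rewrite -[X in _ --> X]subr0.
  by apply: cvgB; [exact: cvg_cst | exact: cvg_harmonic].
- exact: cvg_cst.
Unshelve. all: by end_near. Qed.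

(** The rounded f takes countably many values, one per cell of the grid, and
    on each cell the superposition is the measurable function F ^~ x with x
    fixed; so each preimage is a countable union of measurable sets. *)
Lemma measurable_superposition_grid d (X : measurableType d) (R : realType)
    (D : set X) (F : X -> R -> R) (f : X -> R) (n : nat) :
  measurable_fun D f -> (forall x, measurable_fun D (F ^~ x)) ->
  measurable_fun D (fun s => F s (grid_floor n (f s))).
Proof.
move=> mf mF mD Y mY.
pose x (k : int) : R := k%:~R / n.+1%:R.
pose cell k := D `&` f @^-1` `[x k, x (k + 1)[.
have cellE s k : `[x k, x (k + 1)[%classic (f s) ->
    grid_floor n (f s) = x k.
  rewrite /= in_itv/= /x ler_pdivrMr// ltr_pdivlMr// => fsk.
  by rewrite /grid_floor (floor_def fsk).
have -> : D `&` (fun s => F s (grid_floor n (f s))) @^-1` Y =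
    \bigcup_k (cell k `&` (D `&` (F ^~ (x k)) @^-1` Y)).
  apply/seteqP; split=> [s [Ds Ys]|s [k _ [[_ fsk] [Ds Ys]]]].
    exists (Num.floor (f s * n.+1%:R)) => //; split=> //; split=> //.
    by rewrite /= in_itv/= /x ler_pdivrMr// ltr_pdivlMr// floor_itv.
  by split=> //=; rewrite (cellE _ _ fsk).
apply: countable_bigcupT_measurable => // k.
by apply: measurableI; [apply: mf => //; exact: measurable_itv | exact: mF].
Qed.

(** Joint measurability of F is not assumed: continuity in the second variable
    makes the superposition with f the pointwise limit of the superpositions
    with f rounded down to finer and finer grids. *)
Lemma measurable_superposition {d} {X : measurableType d} {R : realType}
    {D : set X} {F : X -> R -> R} {f : X -> R} :
  measurable_fun D f -> (forall x, measurable_fun D (F ^~ x)) ->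
  (forall s, D s -> continuous (F s)) ->
  measurable_fun D (fun s => F s (f s)).
Proof.
move=> mf mF cF.
apply: (@measurable_fun_cvg _ _ _ _ (fun n s => F s (grid_floor n (f s)))).
  by move=> n; exact: measurable_superposition_grid.
by move=> s Ds; exact: continuous_cvg (cF s Ds (f s)) (cvg_grid_floor (f s)).
Qed.

(** * Lebesgue measurability of continuous and Lipschitz functions *)

Lemma lipschitz_within_continuous {R : realType} {A : set R} {f : R -> R}
    {L : R} :
  0 < L -> (forall x y, A x -> A y -> `|f x - f y| <= L * `|x - y|) ->
  {within A, continuous f}.
Proof.
move=> L0 lipf; apply/subspace_continuousP => x Ax.
apply/cvgrPdist_lt => e e0.
have : nbhs x (ball x (e / L)) by apply: nbhsx_ballx; rewrite divr_gt0.
rewrite /prop_near1 /nbhs/= /within/=; apply: filterS => y + Ay.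
rewrite /ball/= ltr_pdivlMr// mulrC; apply: le_lt_trans; exact: lipf.
Qed.

Lemma lebesgue_measurable_itv (R : realType) (i : interval R) :
  measurable ([set` i] : set (lebesgueType R)).
Proof. by apply: sub_caratheodory; exact: measurable_itv. Qed.

Lemma lebesgue_measurable_funS {R : realType} {i : interval R} {D : set R}
    {f : R -> R} :
  D `<=` [set` i] -> lebesgue_measurable_fun [set` i] f ->
  lebesgue_measurable_fun D f.
Proof.
move=> Di mf; apply: (@measurable_funS _ _ (lebesgueType R) R [set` i]) => //.
exact: lebesgue_measurable_itv.
Qed.

(** Borel sets are Caratheodory-measurable, which transfers measurability from
    the Borel sigma-algebra to its completion. *)
Lemma borel_lebesgue_measurable_fun (R : realType) (D : set R) (f : R -> R) :
  measurable D -> measurable_fun D f -> lebesgue_measurable_fun D f.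
Proof. by move=> mD mf _ Y mY; apply: sub_caratheodory; exact: mf. Qed.

Lemma continuous_lebesgue_measurable_fun (R : realType) (i : interval R)
    (f : R -> R) :
  {within [set` i], continuous f} -> lebesgue_measurable_fun [set` i] f.
Proof.
move=> cf; apply: borel_lebesgue_measurable_fun; first exact: measurable_itv.
by apply: subspace_continuous_measurable_fun => //; exact: measurable_itv.
Qed.

(** * The memory integrand and the memory functional *)

(** On an unbounded set of values the real-valued [sup] is a junk value, hence
    the auxiliary upper bound M. *)
Lemma le_sup_image {X : Type} {R : realType} {A : set X} {g : X -> R} (M : R)
    {x : X} :
  (forall y, A y -> g y <= M) -> A x -> g x <= sup [set g y | y in A].
Proof.
move=> gM Ax; apply: ub_le_sup; last by exists x.
by exists M => _ [y Ay <-]; exact: gM.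
Qed.

Section memory.
Context {R : realType} {T : R} {kappa : R -> R} {Lambda : R -> R -> R}.
Hypothesis kappa_reg : regular_kernel T kappa.
Hypothesis Lambda_adm : adaptive_sensitivity T Lambda.
Implicit Types (f : R -> R) (s t x : R).

Local Notation mu := (@completed_lebesgue_measure R).

Lemma le_sensitivity_sup s x :
  s \in `[0, T] -> Lambda s x <= sensitivity_sup T Lambda.
Proof.
move=> sI; have [m [M [_ _ bM]]] := sensitivity_bounded Lambda_adm.
apply: ub_le_sup; last by exists s => //; exists x.
by exists M => _ [r rI [y _ <-]]; have /andP[] := bM r y rI.
Qed.

Lemma le_kernel_sup s : s \in `[0, T] -> kappa s <= kernel_sup T kappa.
Proof.
have [m [M [_ _ bM]]] := kernel_bounded kappa_reg.
apply: (@le_sup_image _ _ `[0, T]%classic kappa M) => r rI.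
by have /andP[] := bM r rI.
Qed.

Lemma normr_attains_max f : 0 <= T -> continuous_on T f ->
  exists2 c, c \in `[0, T] & forall s, s \in `[0, T] -> `|f s| <= `|f c|.
Proof.
move=> T0 cf; apply: (@EVT_max _ (fun s => `|f s|)) => // r.
by apply: cvg_norm; exact: cf.
Qed.

Lemma le_sup_norm f s :
  continuous_on T f -> s \in `[0, T] -> `|f s| <= sup_norm T f.
Proof.
move=> cf sI.
have T0 : 0 <= T by move: sI; rewrite in_itv/= => /andP[]; exact: le_trans.
have [c _ cmax] := normr_attains_max f T0 cf.
by apply: (@le_sup_image _ _ `[0, T]%classic (fun r => `|f r|) `|f c|).
Qed.

Lemma sub_segment {s t} : t \in `[0, T] -> s \in `[0, t] -> s \in `[0, T].
Proof.
by rewrite !in_itv/= => /andP[_ tT] /andP[-> /le_trans]; apply.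
Qed.

Lemma reflect_segment {s t} : t \in `[0, T] -> s \in `[0, t] ->
  t - s \in `[0, T].
Proof.
rewrite !in_itv/= => /andP[_ tT] /andP[s0 st].
by rewrite subr_ge0 st (le_trans _ tT)// lerBlDr lerDl.
Qed.

Lemma memory_integrand_ge0 f t s : t \in `[0, T] -> s \in `[0, t] ->
  0 <= memory_integrand kappa Lambda f t s.
Proof.
move=> tI sI; apply: mulr_ge0 => //; apply: mulr_ge0.
  exact/(sensitivity_ge0 Lambda_adm)/(sub_segment tI).
exact/(kernel_ge0 kappa_reg)/(reflect_segment tI).
Qed.

Lemma memory_integrand_le f t s : continuous_on T f ->
  t \in `[0, T] -> s \in `[0, t] ->
  memory_integrand kappa Lambda f t s <=
    sensitivity_sup T Lambda * kernel_sup T kappa * sup_norm T f.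
Proof.
move=> cf tI sI.
have sT := sub_segment tI sI; have rT := reflect_segment tI sI.
have L0 := sensitivity_ge0 Lambda_adm (f s) sT.
have k0 := kernel_ge0 kappa_reg rT.
apply: ler_pM => //; [exact: mulr_ge0| |exact: le_sup_norm].
by apply: ler_pM => //; [exact: le_sensitivity_sup|exact: le_kernel_sup].
Qed.

Lemma reflected_kernel_continuous t : t \in `[0, T] ->
  {within `[0, t], continuous (fun s => kappa (t - s))}.
Proof.
move=> tI; have [L L0 lipk] := kernel_lipschitz kappa_reg.
apply: (lipschitz_within_continuous L0) => x y xI yI.
apply: (le_trans (lipk _ _ (reflect_segment tI xI) (reflect_segment tI yI))).
by rewrite opprB addrC subrKA distrC.
Qed.

Lemma sensitivity_continuous s : s \in `[0, T] -> continuous (Lambda s).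
Proof.
move=> sI; have [L L0 lipL] := sensitivity_lipschitz Lambda_adm.
apply/continuous_subspace_setT.
by apply: (lipschitz_within_continuous L0) => x y _ _; exact: lipL.
Qed.

(** Lambda s (f s) is a Caratheodory superposition, and the two other factors of
    the integrand are continuous on [0, t]. *)
Lemma continuous_memory_well_defined f : continuous_on T f ->
  memory_well_defined T kappa Lambda f.
Proof.
move=> cf t tI.
have sub : `[0, t] `<=` `[0, T] by move=> s; exact: (sub_segment tI).
have mf : lebesgue_measurable_fun `[0, t] f.
  exact/continuous_lebesgue_measurable_fun/(continuous_subspaceW sub).
apply: measurable_funM; last exact: measurableT_comp.
apply: measurable_funM; last first.
  exact/continuous_lebesgue_measurable_fun/reflected_kernel_continuous.
have mL x := lebesgue_measurable_funS sub (sensitivity_measurable Lambda_adm x).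
apply: (measurable_superposition (X := lebesgueType R) mf mL).
by move=> s /sub; exact: sensitivity_continuous.
Qed.

Lemma memory_integral_le f t : continuous_on T f -> t \in `[0, T] ->
  (\int[mu]_(s in `[0%R, t]) (memory_integrand kappa Lambda f t s)%:E <=
   (sensitivity_sup T Lambda * kernel_sup T kappa * sup_norm T f * t)%:E)%E.
Proof.
move=> cf tI.
have t0 : 0 <= t by move: tI; rewrite in_itv/= => /andP[].
have mut : mu `[0, t] = t%:E.
  (* both measures are given by the same outer measure *)
  have -> : mu `[0, t] = lebesgue_measure `[0, t] by [].
  rewrite lebesgue_measure_itv/= lte_fin sube0.
  by case: ltgtP t0 => // <-.
rewrite EFinM -mut -integral_cst; last exact: lebesgue_measurable_itv.
apply: ge0_le_integral.
- exact: lebesgue_measurable_itv.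
- by move=> s sI; rewrite lee_fin; exact: memory_integrand_ge0.
- exact/measurable_EFinP/continuous_memory_well_defined.
- exact: measurable_cst.
- by move=> s sI; rewrite lee_fin; exact: memory_integrand_le.
Qed.

Lemma memory_functional_le f : 0 <= T -> continuous_on T f ->
  (memory_functional T kappa Lambda f <=
   ((1 + sensitivity_sup T Lambda * kernel_sup T kappa * T) *
     sup_norm T f)%:E)%E.
Proof.
move=> T0 cf; apply: ge_ereal_sup => _ [t tI <-].
have OI : 0 \in `[0, T] by rewrite in_itv/= lexx.
have ft : (`|f t|%:E <= (sup_norm T f)%:E)%E.
  by rewrite lee_fin; exact: le_sup_norm.
apply: (le_trans (leeD ft (memory_integral_le f t cf tI))).
have /andP[_ tT] : 0 <= t <= T by move: tI; rewrite /= in_itv.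
have L0 : 0 <= sensitivity_sup T Lambda.
  apply: le_trans (le_sensitivity_sup 0 0 OI).
  exact: (sensitivity_ge0 Lambda_adm).
have k0 : 0 <= kernel_sup T kappa.
  by apply: le_trans (le_kernel_sup 0 OI); exact: (kernel_ge0 kappa_reg).
have nf0 : 0 <= sup_norm T f := le_trans (normr_ge0 _) (le_sup_norm f 0 cf OI).
rewrite lee_fin mulrDl mul1r lerD2l mulrAC.
by apply: ler_wpM2r => //; apply: ler_wpM2l => //; exact: mulr_ge0.
Qed.

(** At a maximum point of |f| the first summand of the functional is already the
    sup norm, and the integral only adds to it. *)
Lemma sup_norm_le_memory_functional f : 0 <= T -> continuous_on T f ->
  ((sup_norm T f)%:E <= memory_functional T kappa Lambda f)%E.
Proof.
move=> T0 cf; have [c cI cmax] := normr_attains_max f T0 cf.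
apply: (@le_trans _ _ (`|f c|%:E)).
  rewrite lee_fin; apply: ge_sup; first by exists `|f c|, c.
  by move=> _ [s sI <-]; exact: cmax.
apply: le_trans (ereal_sup_ubound _); last by exists c.
by rewrite leeDl// integral_ge0// => s sI; rewrite lee_fin memory_integrand_ge0.
Qed.

End memory.

Theorem theorem4p2 (R : realType) (T : R) (kappa : R -> R)
    (Lambda : R -> R -> R) (T_gt0 : 0 < T)
    (kappa_reg : regular_kernel T kappa)
    (Lambda_adm : adaptive_sensitivity T Lambda) :
  (continuous_on T `<=` memory_set T kappa Lambda /\
   memory_set T kappa Lambda !=set0) /\
  (forall f : R -> R, continuous_on T f ->
    ((sup_norm T f)%:E <= memory_functional T kappa Lambda f)%E /\
    (memory_functional T kappa Lambda f <=
      ((1 + sensitivity_sup T Lambda * kernel_sup T kappa * T) *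
        sup_norm T f)%:E)%E).
Proof.
have T0 := ltW T_gt0.
have sub : continuous_on T `<=` memory_set T kappa Lambda.
  move=> f cf; split; first exact: continuous_memory_well_defined.
  apply: le_lt_trans (ltry _).
  exact: (memory_functional_le kappa_reg Lambda_adm f T0 cf).
split=> [|f cf].
  by split=> //; exists (cst 0); apply: sub => x; exact: cvg_cst.
by split; [exact: sup_norm_le_memory_functional|exact: memory_functional_le].
Qed.
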